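(* Let $G$ be a strongly co-Hopfian abelian group. Then $G$ is cotorsion if and only if $G$ is algebraically compact.
   Context: All groups are abelian. A group $G$ is strongly co-Hopfian if for every endomorphism $f$ of $G$ there is $n\in\mathbb N$ with $f^n(G)=f^{n+1}(G)$. A group $G$ is cotorsion if $\mathrm{Ext}(\mathbb Q,G)=0$, equivalently $G$ is a direct summand of every group $H$ containing $G$ with $H/G$ torsion-free. *)

(* Defs.v *)
From mathcomp Require Import all_boot all_algebra.
Set Implicit Arguments. Unset Strict Implicit. Unset Printing Implicit Defensive.
Import GRing.Theory.
Local Open Scope ring_scope.

Definition strongly_coHopfian (G : zmodType) : Prop :=
  forall f : {additive G -> G}, exists n : nat,
    forall y : G, (exists x, y = iter n f x) <-> (exists x, y = iter n.+1 f x).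

(* G is cotorsion: G is a direct summand of every group H containing it
   (via an injective homomorphism i) with H / i(G) torsion-free.
   "Direct summand" = there is a homomorphism r : H -> G with r \o i = id. *)
Definition cotorsion (G : zmodType) : Prop :=
  forall (H : zmodType) (i : {additive G -> H}), injective i ->
    (forall (h : H) (n : nat), (0 < n)%N ->
        (exists g, h *+ n = i g) -> exists g, h = i g) ->
    exists r : {additive H -> G}, cancel i r.

(* G is algebraically compact (= pure-injective): G is a direct summand of
   every group H containing it as a pure subgroup, i.e. n H \cap i(G) = n i(G)
   for all n. *)
Definition algebraically_compact (G : zmodType) : Prop :=
  forall (H : zmodType) (i : {additive G -> H}), injective i ->
    (forall (h : H) (n : nat),
        (exists g, h *+ n = i g) -> exists g, h *+ n = i (g *+ n)) ->
    exists r : {additive H -> G}, cancel i r.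

(* Main.v *)
Require Import Defs.
From mathcomp Require Import all_boot all_algebra.
From mathcomp Require Import boolp classical_sets.
From HB Require Import structures.

(** Only the multiplications by primes are needed among the endomorphisms of
    [G]: for every prime [p] there is [n] with [p^n G = p^(n+1) G].  Let [G] be
    pure in [H].  By Zorn's lemma there is a maximal homomorphism from a subgroup
    [C] of [H] containing [G] to [G] that is the identity on [G] and maps
    [C] ∩ [q^m H] into [q^m G] for all primes [q] and all [m].  Stabilisation of
    the [p^n G] allows one to extend such a homomorphism to any [b] with [p b] in
    [C], so that [H / C] is torsion-free.  Pushing out the inclusion of [C] in
    [H] along the homomorphism then embeds [G] in a group with torsion-free
    quotient [H / C], and cotorsion gives the retraction. *)

Set Implicit Arguments. Unset Strict Implicit. Unset Printing Implicit Defensive.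
Import GRing.Theory.
Local Open Scope classical_set_scope.
Local Open Scope ring_scope.

(** * Subgroups, multiples and adjunction of one element *)

Section Subgroups.
Variable V : zmodType.
Implicit Types (X : set V) (x y z : V).

Definition subgroup X := X 0 /\ forall x y, X x -> X y -> X (x - y).

Lemma subgroup_opp X x : subgroup X -> X x -> X (- x).
Proof. by move=> [X0 XB] Xx; rewrite -[- x]add0r; apply: XB. Qed.

Lemma subgroup_add X x y : subgroup X -> X x -> X y -> X (x + y).
Proof.
by move=> sX Xx Xy; rewrite -[y]opprK; apply: sX.2 => //; apply: subgroup_opp.
Qed.

Lemma subgroup_mulz X x (j : int) : subgroup X -> X x -> X (x *~ j).
Proof.
move=> sX Xx.
have Xn n : X (x *+ n).
  by elim: n => [|n IHn]; [exact: sX.1 | rewrite mulrS; apply: subgroup_add].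
by case: j => n; rewrite ?NegzE ?mulrNz -pmulrn //; apply: subgroup_opp.
Qed.

Lemma subgroup_bezout X x (m n u v : int) : subgroup X -> u * m + v * n = 1 ->
  X (x *~ m) -> X (x *~ n) -> X x.
Proof.
move=> sX uv Xm Xn; rewrite -[x]mulr1z -uv mulrzDr.
by apply: subgroup_add => //; rewrite mulrC mulrzA; apply: subgroup_mulz.
Qed.

Definition multiples (n : nat) : set V := [set x | exists y, x = y *+ n].

Lemma multiples_subgroup n : subgroup (multiples n).
Proof.
split=> [|_ _ [x ->] [y ->]]; first by exists 0; rewrite mul0rn.
by exists (x - y); rewrite mulrnBl.
Qed.

Lemma multiples_dvd m n : (m %| n)%N -> multiples n `<=` multiples m.
Proof. by move=> /dvdnP[d ->] _ [y ->]; exists (y *+ d); rewrite -mulrnA. Qed.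

Definition adjoin X z : set V :=
  [set y | exists2 x, X x & exists j : int, y = x + z *~ j].

Lemma adjoin_subgroup X z : subgroup X -> subgroup (adjoin X z).
Proof.
move=> sX; split=> [|_ _ [x Xx [j ->]] [y Xy [k ->]]].
  by exists 0; [exact: sX.1 | exists 0; rewrite mulr0z addr0].
exists (x - y); first exact: sX.2.
by exists (j - k); rewrite mulrzBr opprD addrACA.
Qed.

Lemma sub_adjoin X z : X `<=` adjoin X z.
Proof. by move=> x Xx; exists x => //; exists 0; rewrite mulr0z addr0. Qed.

Lemma mem_adjoin X z : subgroup X -> adjoin X z z.
Proof.
by move=> [X0 _]; exists 0 => //; exists 1; rewrite mulr1z add0r.
Qed.

End Subgroups.

Lemma coprime_bezoutz (p : nat) (j : int) : prime p -> ~~ (p%:Z %| j)%Z ->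
  exists uv : int * int, uv.1 * p%:Z + uv.2 * j = 1.
Proof.
move=> pp; rewrite dvdzE /= -prime_coprime // => co.
by apply/coprimezP; rewrite coprimezE.
Qed.

Lemma pairMz (U V : zmodType) (x : U) (y : V) (j : int) :
  (x, y) *~ j = (x *~ j, y *~ j).
Proof.
rewrite [LHS]surjective_pairing (raddfMz (fst : {additive U * V -> U})).
by rewrite (raddfMz (snd : {additive U * V -> V})).
Qed.

Lemma subgroup_image (U V : zmodType) (f : {additive U -> V}) (X : set U) :
  subgroup X -> subgroup (f @` X).
Proof.
move=> sX; split=> [|_ _ [x Xx <-] [y Xy <-]] /=.
  by exists 0; [exact: sX.1 | rewrite raddf0].
by exists (x - y); [exact: sX.2 | rewrite raddfB].
Qed.

(** The hypothesis is applied to multiplication by [p], whose iterates are multiplications by powers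
    of [p]. With [minn], divisibility in [G] need only be checked up to exponent [n]. *)
Lemma strongly_coHopfian_multiples (G : zmodType) (p : nat) :
  strongly_coHopfian G ->
  exists n, forall m, multiples (V := G) (p ^ minn m n) `<=` multiples (p ^ m).
Proof.
move=> scG.
pose f (x : G) := x *+ p.
have f_add : zmod_morphism f by move=> x y; rewrite /f mulrnBl.
pose fA : {additive G -> G} :=
  HB.pack f (GRing.isZmodMorphism.Build _ _ f f_add).
have iterE k x : iter k fA x = x *+ (p ^ k).
  by elim: k => [|k IHk]; rewrite ?expn0 // iterS IHk /= /f -mulrnA expnSr.
have [n nP] := scG fA; exists n => m.
have step : multiples (V := G) (p ^ n) `<=` multiples (p ^ n.+1).
  move=> x [y ->]; have [|z] := (nP (y *+ (p ^ n))).1.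
    by exists y; rewrite iterE.
  by rewrite iterE => ->; exists z.
case: (leqP m n) => [_ x //|/ltnW/subnKC <-].
elim: (m - n)%N => [|d IHd]; first by rewrite addn0.
move=> x /IHd [y ->]; rewrite [in X in _ X]expnD mulrnA.
have [|z ->] := step (y *+ (p ^ n)); first by exists y.
by exists z; rewrite addnS -addSn expnD mulrnA.
Qed.

(** * Partial retractions and the domain of a maximal one *)

Section PartialRetractions.
Variables (G H : zmodType) (i : {additive G -> H}).

(* A partial homomorphism from [H] to [G] is represented by its graph. *)
Definition partial_retraction (X : set (H * G)) : Prop :=
  [/\ subgroup X, forall g, X (i g, g), forall g, X (0, g) -> g = 0
    & forall q m h g, prime q -> X (h, g) ->
        multiples (q ^ m) h -> multiples (q ^ m) g].

Lemma partial_retraction_start : injective i ->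
  (forall (h : H) (n : nat),
     (exists g, h *+ n = i g) -> exists g, h *+ n = i (g *+ n)) ->
  partial_retraction [set x | x.1 = i x.2].
Proof.
move=> i_inj i_pure; split => //=.
- split=> [|[h g] [h' g'] /= -> ->]; first by rewrite /= raddf0.
  by rewrite raddfB.
- by move=> g; rewrite -(raddf0 i) => /i_inj.
move=> q m h g _ -> [h' ihE].
have [|g' g'E] := i_pure h' (q ^ m)%N; first by exists g.
by exists g'; apply: i_inj; rewrite ihE.
Qed.

Lemma partial_retraction_bigcup (F : set (set (H * G))) : F !=set0 ->
  F `<=` partial_retraction -> total_on F subset ->
  partial_retraction (\bigcup_(X in F) X).
Proof.
move=> [X0 FX0] FP Ftot; have [sX0 X0i _ _] := FP _ FX0; split.
- split=> [|x y [X FX Xx] [Y FY Yy]]; first by exists X0 => //; apply: sX0.1.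
  have [[sX _ _ _] [sY _ _ _]] := (FP _ FX, FP _ FY).
  by have [XY|YX] := Ftot _ _ FX FY;
    [exists Y => //; apply: sY.2 => //; apply: XY
    |exists X => //; apply: sX.2 => //; apply: YX].
- by move=> g; exists X0.
- by move=> g [X FX]; have [_ _ + _] := FP _ FX; apply.
by move=> q m h g pq [X FX]; have [_ _ _ hX] := FP _ FX; apply: hX.
Qed.

Lemma maximal_partial_retraction : injective i ->
  (forall (h : H) (n : nat),
     (exists g, h *+ n = i g) -> exists g, h *+ n = i (g *+ n)) ->
  exists2 X, partial_retraction X
    & forall Y, partial_retraction Y -> X `<=` Y -> Y `<=` X.
Proof.
move=> i_inj i_pure; have start := partial_retraction_start i_inj i_pure.
pose P : set (set (H * G)) := [set X | X = set0 \/ partial_retraction X].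
have [F FP Ftot|X [PX Xmax]] := @Zorn_bigcup _ P.
  pose F' := F `&` partial_retraction.
  have -> : \bigcup_(X in F) X = \bigcup_(X in F') X.
    apply/seteqP; split=> [x [X FX Xx]|x [X [FX _] Xx]]; last by exists X.
    exists X => //; split=> //; have [X0|//] := FP _ FX.
    by move: Xx; rewrite X0.
  have [F'0|/set0P/negP/negPn/eqP ->] := pselect (F' !=set0); last first.
    by left; rewrite bigcup_set0.
  right; apply: partial_retraction_bigcup => // [X []//|X Y [FX _] [FY _]].
  exact: Ftot.
have PrX : partial_retraction X.
  case: PX => // X0; case: (Xmax _ _ (or_intror start)); rewrite X0.
  by split=> // /(_ (0, 0)) /=; apply; rewrite raddf0.
exists X => // Y PrY XY; apply: contrapT => YX.
by apply: (Xmax Y); [split | right].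
Qed.

(* The value at a new element [b] with [p b] in the domain is chosen after
   moving [b] within its coset to the largest [p]-height [k <= n], where [n] is
   the exponent at which the powers of [p] stabilise on [G].  Heights of the
   other elements of the coset, capped at [n], are then at most [k]. *)
Lemma maximal_partial_retraction_prime (X : set (H * G)) (p n : nat) (b : H) :
  partial_retraction X ->
  (forall Y, partial_retraction Y -> X `<=` Y -> Y `<=` X) ->
  prime p ->
  (forall m, multiples (V := G) (p ^ minn m n) `<=` multiples (p ^ m)) ->
  (fst @` X) (b *+ p) -> (fst @` X) b.
Proof.
move=> [sX Xi X0 Xht] Xmax pp stab.
pose D : set H := fst @` X.
have sD : subgroup D.
  by apply: (@subgroup_image _ _ (fst : {additive H * G -> H})).
move=> Dpb; apply: contrapT => nDb.
pose Q k := `[< (k <= n)%N /\ exists2 c, D c & multiples (p ^ k) (b + c) >].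
have Q0 : exists k, Q k.
  exists 0%N; apply/asboolP; split=> //; exists 0; first exact: sD.1.
  by exists b; rewrite addr0.
have Qn k : Q k -> (k <= n)%N by move=> /asboolP[].
have [k /asboolP[kn [c Dc [b' b'E]]] kmax] := ex_maxnP Q0 Qn.
set b1 := b + c in b'E.
have Dpb1 : D (b1 *+ p).
  rewrite mulrnDl; apply: subgroup_add => //.
  by rewrite pmulrn; apply: subgroup_mulz.
have nDb1 : ~ D b1.
  by move=> Db1; apply: nDb; rewrite -[b](addrK c); apply: sD.2.
have [[w g1] Xg1 /= wE] := Dpb1; rewrite wE in Xg1.
(* As [b1] is [p ^ k] times [b'], the element [b1 *+ p] has height at least [k.+1], hence so does
   its image [g1]. Dividing [g1] by [p] then leaves a value [a] for [b1] that is still divisible by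
   [p ^ k]. *)
have [|a' g1E] := Xht p k.+1 _ _ pp Xg1.
  by exists b'; rewrite b'E -mulrnA expnSr.
set a := a' *+ (p ^ k).
have apE : a *+ p = g1 by rewrite -mulrnA -expnSr.
pose z : H * G := (b1, a).
have Xzp j : X (z *~ (j * p%:Z)).
  rewrite mulrC mulrzA; apply: subgroup_mulz => //.
  by rewrite pairMz -!pmulrn apE.
(* When [p] divides the coefficient of [z], the element is already in [X]; below, only coefficients
   prime to [p] need work. *)
have dvd_case x j : (p%:Z %| j)%Z -> X x -> X (x + z *~ j).
  by move=> /dvdzP[j' ->] Xx; apply: subgroup_add.
suff /Xmax : partial_retraction (adjoin X z).
  move=> /(_ (@sub_adjoin _ X z)) /(_ z (mem_adjoin z sX)) Xz.
  by apply: nDb1; exists z.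
split; first exact: adjoin_subgroup.
- by move=> g; apply: sub_adjoin.
- move=> g [x Xx [j xE]].
  have [/dvd_case/(_ Xx)|] := boolP (p%:Z %| j)%Z; first by rewrite -xE => /X0.
  (* Here [b1 *~ j] and [b1 *+ p] both lie in [D], so by Bezout [b1] does too. *)
  move=> /(coprime_bezoutz pp)[[u v] /= uv]; case: nDb1.
  apply: (subgroup_bezout sD uv); first by rewrite -pmulrn.
  case: x xE Xx => h g'; rewrite pairMz => -[/esym/eqP + _].
  rewrite addrC addr_eq0 => /eqP -> Xx.
  by apply: subgroup_opp => //; exists (h, g').
move=> q m h g pq [x Xx [j xE]] hq.
have [/dvd_case/(_ Xx)|] := boolP (p%:Z %| j)%Z.
  by rewrite -xE => /(Xht q m _ _ pq); apply.
move=> /(coprime_bezoutz pp)[[u v] /= uv].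
case: x xE Xx => h0 g0; rewrite pairMz => -[hE gE] Xx.
have [qp|qp] := eqVneq q p.
  move: hq; rewrite {}qp => hp.
  pose m' := minn m n.
  have hm' : multiples (p ^ m') h.
    by apply: multiples_dvd hp; apply: dvdn_exp2l; apply: geq_minl.
  (* Since [v * j] is 1 modulo [p], the multiple [h *~ v] lies in the coset of [b] modulo [D], so
     maximality of [k] applies to it. Consequently [b1] and [a] are divisible by [p ^ m'], which
     reduces the claim to [h0] and [g0]. *)
  have m'k : (m' <= k)%N.
    apply: kmax; apply/asboolP; split; first exact: geq_minr.
    exists (c + (h0 *~ v - b1 *~ (u * p%:Z))).
      apply: subgroup_add => //; apply: sD.2.
        by apply: subgroup_mulz => //; exists (h0, g0).
      by exists (z *~ (u * p%:Z)); rewrite // pairMz.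
    suff -> : b + (c + (h0 *~ v - b1 *~ (u * p%:Z))) = h *~ v.
      exact: subgroup_mulz (multiples_subgroup _ _) hm'.
    rewrite addrA -/b1 hE mulrzDl -[(b1 *~ j) *~ v]mulrzA addrCA.
    congr (_ + _); rewrite -[X in X - _]mulr1z -mulrzBr -uv.
    by rewrite addrC addKr mulrC.
  have sm (V : zmodType) := @multiples_subgroup V (p ^ m').
  have b1m : multiples (p ^ m') b1.
    by apply: (@multiples_dvd _ _ (p ^ k)); [exact: dvdn_exp2l | exists b'].
  have am : multiples (p ^ m') a.
    by apply: (@multiples_dvd _ _ (p ^ k)); [exact: dvdn_exp2l | exists a'].
  apply: stab; rewrite gE; apply: subgroup_add => //; last exact: subgroup_mulz.
  apply: Xht Xx _ => //.
  have -> : h0 = h - b1 *~ j by rewrite hE addrK.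
  by apply: (sm H).2 => //; apply: subgroup_mulz.
(* For [q] different from [p], the pair multiplied by [p] lies in [X], so [g *~ p] is divisible by
   [q ^ m]; as [p] is prime to [q ^ m], so is [g]. *)
have [|[u' v'] /= uv'] := @coprime_bezoutz p (q ^ m)%N%:Z pp.
  by rewrite dvdzE /= Euclid_dvdX // negb_and dvdn_prime2 // eq_sym qp.
have sm := @multiples_subgroup G (q ^ m).
apply: (subgroup_bezout sm uv'); last by exists g; rewrite -pmulrn.
apply: (Xht q m (h *~ p%:Z)) => //.
  have -> : (h *~ p%:Z, g *~ p%:Z) = (h0, g0) *~ p%:Z + z *~ (j * p%:Z).
    by rewrite !pairMz hE gE !mulrzDl -!mulrzA.
  by apply: subgroup_add => //; apply: subgroup_mulz.
exact: subgroup_mulz (multiples_subgroup _ _) hq.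
Qed.

(** Strong induction on [m], cancelling one prime divisor at a time. *)
Lemma maximal_partial_retraction_torsion_free (X : set (H * G)) :
  strongly_coHopfian G -> partial_retraction X ->
  (forall Y, partial_retraction Y -> X `<=` Y -> Y `<=` X) ->
  forall h m, (0 < m)%N -> (fst @` X) (h *+ m) -> (fst @` X) h.
Proof.
move=> scG PrX Xmax h m; elim/ltn_ind: m h => m IHm h m0 Dhm.
have [m1|m1] := leqP m 1.
  by move: Dhm; rewrite (_ : m = 1%N) //; apply/eqP; rewrite eqn_leq m1.
have pp := pdiv_prime m1.
have [n stab] := strongly_coHopfian_multiples (pdiv m) scG.
apply: (IHm (m %/ pdiv m)%N).
- by rewrite ltn_Pdiv // prime_gt1.
- by rewrite divn_gt0 ?pdiv_gt0 // dvdn_leq // pdiv_dvd.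
apply: (maximal_partial_retraction_prime PrX Xmax pp stab).
by rewrite -mulrnA divnK // pdiv_dvd.
Qed.

End PartialRetractions.

(** * The pushout and extension by cotorsion *)

Section Pushout.
Variables (G H : zmodType) (X : set (H * G)) (sX : subgroup X).

(* The sign makes [(h, 0)] and [(0, g)] equal in the quotient exactly when
   [(h, g)] lies on the graph [X]. *)
Definition pushout_relations of subgroup X : {pred H * G} :=
  fun x => `[< X (x.1, - x.2) >].

Lemma pushout_relations_closed : zmod_closed (pushout_relations sX).
Proof.
split=> [|[h g] [h' g'] /asboolP /= Xx /asboolP /= Xy].
  by apply/asboolP; rewrite /= oppr0; apply: sX.1.
by apply/asboolP => /=; rewrite opprD; apply: (sX.2 _ _ Xx Xy).
Qed.

HB.instance Definition _ :=
  GRing.isZmodClosed.Build (H * G)%type (pushout_relations sX)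
    pushout_relations_closed.

Definition pushout : zmodType := Quotient.quot (pushout_relations sX).

Definition pushout_proj (x : H * G) : pushout :=
  (\pi_(Quotient.quot (pushout_relations sX)) x)%qT.

Lemma pushout_proj_additive : zmod_morphism pushout_proj.
Proof. exact: raddfB. Qed.

HB.instance Definition _ :=
  GRing.isZmodMorphism.Build (H * G)%type pushout pushout_proj
    pushout_proj_additive.

Lemma pushout_projP x y :
  pushout_proj x = pushout_proj y <-> X (x.1 - y.1, y.2 - x.2).
Proof.
have -> : y.2 - x.2 = - (x - y).2 by rewrite opprB.
split=> [/eqP|Xxy].
  by rewrite -[_ == _]Quotient.idealrBE => /asboolP.
by apply/eqP; rewrite -[_ == _]Quotient.idealrBE; apply/asboolP.
Qed.

Lemma pushout_projE u : exists x, u = pushout_proj x.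
Proof. by exists (repr u); rewrite /pushout_proj reprK. Qed.

End Pushout.

(** [G] embeds in the pushout with quotient [H] modulo the domain of [X], which is torsion-free.
    Cotorsion retracts the pushout onto [G], and composing with the map from [H] gives the
    extension. *)
Lemma cotorsion_extend (G H : zmodType) (X : set (H * G)) :
  cotorsion G -> subgroup X -> (forall g, X (0, g) -> g = 0) ->
  (forall h m, (0 < m)%N -> (fst @` X) (h *+ m) -> (fst @` X) h) ->
  exists r : {additive H -> G}, forall h g, X (h, g) -> r h = g.
Proof.
move=> cG sX X0 Xtf.
pose inG (g : G) := pushout_proj sX (0, g).
have inG_add : zmod_morphism inG.
  move=> x y; rewrite /inG -raddfB.
  by congr pushout_proj; congr pair; rewrite subr0.
pose inGA : {additive G -> pushout sX} :=
  HB.pack inG (GRing.isZmodMorphism.Build _ _ inG inG_add).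
have [g g' /pushout_projP /=||r rK] := cG _ inGA.
- by rewrite subr0 => /X0/eqP; rewrite subr_eq0 => /eqP.
- move=> u m m0 [g]; have [[h g0] ->] := pushout_projE u.
  rewrite -raddfMn => /pushout_projP /=; rewrite subr0 => Xhm.
  have [|[h' a] Xa /= h'E] := Xtf h m m0.
    by eexists; [exact: Xhm | rewrite /= (raddfMn (fst : {additive H * G -> H}))].
  (* The pair [(h, a)] is in [X], so [(h, 0)] and [(0, a)] have the same class. *)
  by exists (g0 + a); apply/pushout_projP; rewrite /= subr0 -h'E addrAC subrr add0r.
pose inH (h : H) := r (pushout_proj sX (h, 0)).
have inH_add : zmod_morphism inH.
  move=> x y; rewrite /inH -!raddfB.
  by congr (r (pushout_proj _ (_, _))); rewrite subr0.
pose inHA : {additive H -> G} :=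
  HB.pack inH (GRing.isZmodMorphism.Build _ _ inH inH_add).
exists inHA => h g Xhg /=.
rewrite /inH -[RHS](rK g); congr (r _); apply/pushout_projP.
by rewrite /= !subr0.
Qed.

(** A subgroup with torsion-free quotient is pure: for positive [n], [h] itself comes from [G],
    while [n = 0] is trivial. *)
Lemma algebraically_compact_cotorsion (G : zmodType) :
  algebraically_compact G -> cotorsion G.
Proof.
move=> acG H i i_inj i_tf; apply: acG => // h [_|n [g hE]].
  by exists 0; rewrite !mulr0n raddf0.
have [|g' ->] := i_tf h n.+1 isT; first by exists g.
by exists g'; rewrite raddfMn.
Qed.

Theorem mainTheorem7 (G : zmodType) :
  strongly_coHopfian G -> (cotorsion G <-> algebraically_compact G).
Proof.
move=> scG; split; last exact: algebraically_compact_cotorsion.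
move=> cG H i i_inj i_pure.
have [X PrX Xmax] := maximal_partial_retraction i_inj i_pure.
have [sX Xi X0 _] := PrX.
have [|r rX] := cotorsion_extend cG sX X0.
  exact: maximal_partial_retraction_torsion_free scG PrX Xmax.
by exists r => g; apply: rX.
Qed.
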